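(* Let $\theta_1,\dots,\theta_k$ be real numbers and let $\mathcal{P}=(\Pi_1,\dots,\Pi_s)$ be a partition of $\{1,2,\dots,k\}$. The following are equivalent: (i) $\mathcal{P}$ is non-degenerate. (ii) There is a pair of distinct indices $1\le r_1,r_2\le s$ such that no sequence of integers $\ell_1,\dots,\ell_k$ satisfies all of the following: (a) $\sum_{j=1}^k\ell_j\theta_j=0$; (b) $\sum_{j\in\Pi_r}\ell_j=0$ for all $r\ne r_1,r_2$; (c) $\sum_{j\in\Pi_{r_1}}\ell_j=-1$ and $\sum_{j\in\Pi_{r_2}}\ell_j=1$.
   Context: For real $x$, $\|x\|=\min\{|x-n|:n\in\mathbb{Z}\}$. The partition $\mathcal{P}$ (with respect to $\theta_1,\dots,\theta_k$) is non-degenerate if there is a vector $(\rho_1,\dots,\rho_s)\in\mathbb{R}^s$, not constant mod 1 (not all $\rho_r$ congruent mod 1), such that for every $\varepsilon>0$ there is $t>0$ with $\|t\theta_j-\rho_r\|<\varepsilon$ for all $1\le r\le s$ and all $j\in\Pi_r$. The parts of a partition are non-empty. *)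

(* Defs.v *)
From mathcomp Require Import all_boot all_order all_algebra.
From mathcomp Require Import all_classical all_reals.

Set Implicit Arguments.
Unset Strict Implicit.
Unset Printing Implicit Defensive.

Import Order.TTheory GRing.Theory Num.Theory.

Local Open Scope ring_scope.
Local Open Scope classical_set_scope.

(* The index sets {1, ..., k} and {1, ..., s} are 'I_k and 'I_s throughout. *)

Definition dist_int (R : realType) (x : R) : R :=
  inf [set `|x - n%:~R| | n in [set: int]].

(* The infimum defining [dist_int] is a minimum. *)
Lemma dist_int_min (R : realType) (x : R) :
  (exists n : int, dist_int x = `|x - n%:~R|) /\
  (forall n : int, dist_int x <= `|x - n%:~R|).
Proof.
set A := [set `|x - n%:~R| | n in [set: int]].
have lbA : has_lbound A by exists 0 => _ [n _ <-].
have leA (n : int) : dist_int x <= `|x - n%:~R| by apply: ge_inf => //; exists n.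
split=> //; set f := Num.floor x.
have fx : f%:~R <= x by exact: floor_le.
have xf : x < (f + 1)%:~R by exact: floorD1_gt.
have lo (n : int) : n <= f -> `|x - f%:~R| <= `|x - n%:~R|.
  move=> nf; have nfR : (n%:~R : R) <= f%:~R by rewrite ler_int.
  by rewrite !ger0_norm ?subr_ge0 ?lerD2l ?lerN2 // (le_trans nfR).
have hi (n : int) : f < n -> `|x - (f + 1)%:~R| <= `|x - n%:~R|.
  move=> fn; have fnR : ((f + 1)%:~R : R) <= n%:~R by rewrite ler_int lezD1.
  rewrite !(distrC x) !ger0_norm ?subr_ge0 ?lerD2r ?(ltW xf) //.
  exact: le_trans (ltW xf) fnR.
have [ab|ba] := leP `|x - f%:~R| `|x - (f + 1)%:~R|; [exists f|exists (f + 1)];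
  apply/eqP; rewrite eq_le leA /=; (apply: lb_le_inf; first by exists `|x - 0|, 0);
  move=> _ [n _ <-]; have [nf|fn] := leP n f.
- exact: lo.
- exact: le_trans ab (hi _ fn).
- exact: le_trans (ltW ba) (lo _ nf).
- exact: hi.
Qed.

Definition congr_mod1 (R : realType) (x y : R) : Prop :=
  exists n : int, x - y = n%:~R.

(* Since [partition] excludes the empty set and makes distinct blocks disjoint,
   with injectivity this says that (Pi_1, ..., Pi_s) lists the (non-empty)
   parts of a partition of {1, ..., k} without repetition. *)
Definition is_ordered_partition (k s : nat) (Pi : 'I_s -> {set 'I_k}) : Prop :=
  injective Pi /\ finset.partition [set Pi r | r : 'I_s]%SET [set: 'I_k]%SET.

Definition non_degenerate (R : realType) (k s : nat) (theta : 'I_k -> R)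
    (Pi : 'I_s -> {set 'I_k}) : Prop :=
  exists rho : 'I_s -> R,
    ~ (forall r1 r2 : 'I_s, congr_mod1 (rho r1) (rho r2)) /\
    forall eps : R, 0 < eps ->
      exists2 t : R, 0 < t &
        forall (r : 'I_s) (j : 'I_k), j \in Pi r ->
          dist_int (t * theta j - rho r) < eps.

(* Main.v *)
Require Import Defs.
From mathcomp Require Import all_boot all_order all_algebra.
From mathcomp Require Import all_classical all_reals.
From mathcomp Require Import trigo complex ring lra.

(** Write [part j] for the index of the part containing [j], and for an integer
vector [l] with [\sum_j l j * theta j = 0] (a relation) let
[m r = \sum_(j in Pi r) l j] be its vector of part sums.  The part sums of all
relations form a subgroup [M] of Z^s, and (ii) says that for some distinct [r1],
[r2] the vector [e_r2 - e_r1] is not in [M].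

If [t theta j] tends to [rho (part j)] mod 1 along some values of [t], a relation
[l] gives [\sum_r m r * rho r] in Z, because [\sum_j l j * (t theta j) = 0]
exactly ([limit_phase_int]).  A relation with [m = e_r2 - e_r1] therefore forces
[rho r2] and [rho r1] to agree mod 1; if every pair has such a relation, [rho] is
constant mod 1.  This is (i) => (ii).

Conversely, if [e_r2 - e_r1] is not in [M], some character of Z^s with values in
R/Z kills [M] but not [e_r2 - e_r1], since R/Z is divisible
([separating_character]).  Its values on the standard basis form [rho].  It is
not constant mod 1, and [\sum_j l j * rho (part j)] is an integer for every
relation [l].  Kronecker's theorem ([kronecker]) says that this compatibility is
enough for [t theta j] to approach all [rho (part j)] mod 1 at once.

Kronecker's theorem is proved by Bohr's method.  Let e(x) = exp(2 pi i x), which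
is [circ x], and F(t) = \sum_(i in T) e(t theta i - alpha i).  Expanding F^p over
words of length [p] in [T], words with the same frequency have the same phase by
compatibility, so their terms add up without cancellation.  Words with the same
letter counts have the same frequency, so there are at most [(p + 1)^#|T|]
frequencies.  Each coefficient of a trigonometric sum is bounded by the supremum
of its modulus ([coef_le_sup]); hence |F| <= q for all positive [t] would give
[#|T|^p <= (p + 1)^#|T| * q^p] for every [p], which forces [#|T| <= q].  So F
comes as close as desired to its trivial bound [#|T|], and then all its terms are
nearly equal.  One of them is the constant 1 (frequency and phase both 0), so all
are near 1. *)

Set Implicit Arguments.
Unset Strict Implicit.
Unset Printing Implicit Defensive.

Import Order.TTheory GRing.Theory Num.Theory.

Local Open Scope ring_scope.
Local Open Scope complex_scope.

(** * The circle and trigonometric sums *)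

Definition circ (R : realType) (x : R) : R[i] :=
  cos (2 * pi * x) +i* sin (2 * pi * x).

Lemma circD (R : realType) (x y : R) : circ (x + y) = circ x * circ y.
Proof. by rewrite /circ mulrDr cosD sinD [X in _ +i* X]addrC. Qed.

Lemma circ0 (R : realType) : circ 0 = 1 :> R[i].
Proof. by rewrite /circ mulr0 cos0 sin0 complexr0. Qed.

Lemma circ1 (R : realType) : circ 1 = 1 :> R[i].
Proof. by rewrite /circ mulr1 mulr_natl cos2pi sin2pi. Qed.

Lemma circ_half (R : realType) : circ 2^-1 = -1 :> R[i].
Proof.
rewrite /circ (_ : 2 * pi * 2^-1 = pi); last by field.
by rewrite cospi sinpi; apply/eqP; rewrite eq_complex /= oppr0 !eqxx.
Qed.

Lemma circN (R : realType) (x : R) : circ (- x) = (circ x)^-1.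
Proof.
have xK : circ x * circ (- x) = 1 by rewrite -circD subrr circ0.
by rewrite -[RHS]mulr1 -xK mulKf //; apply/eqP => x0; move/eqP: xK;
  rewrite x0 mul0r eq_sym oner_eq0.
Qed.

Lemma circ_int (R : realType) (n : int) : circ (n%:~R : R) = 1.
Proof.
have nat1 (m : nat) : circ (m%:R : R) = 1.
  by elim: m => [|m IH]; rewrite ?circ0 // -addn1 natrD circD IH circ1 mulr1.
by case: n => m; rewrite ?NegzE ?mulrNz ?circN nat1 ?invr1.
Qed.

Lemma circ_sum (R : realType) (I : finType) (f : I -> R) :
  circ (\sum_i f i) = \prod_i circ (f i).
Proof. by apply: (big_morph (@circ R) (@circD R) (@circ0 R)). Qed.

Lemma norm_circ (R : realType) (x : R) : `|circ x| = 1.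
Proof. by rewrite normc_def /= cos2Dsin2 sqrtr1. Qed.

Lemma norm_circD1 (R : realType) (x : R) :
  `|1 + circ x| = (Num.sqrt (2 + 2 * cos (2 * pi * x)))%:C.
Proof.
rewrite normc_def /= add0r; congr (Num.sqrt _)%:C.
by have := cos2Dsin2 (2 * pi * x); lra.
Qed.

(** Averaging f(t) with e(- mu h) f(t + h) does not increase the supremum, keeps
the coefficient at frequency [mu] and multiplies the one at [nu] by
[(1 + e((nu - mu) h)) / 2].  For [h = 1 / (2 |nu - mu|)] this factor is 0, so
finitely many two-point averages isolate the frequency [mu] exactly, with no
limit of means.  The shifts [h] are positive, hence positive [t] suffice. *)
Lemma coef_le_sup (R : realType) (I : finType) (lam : I -> R) (mu : R)
    (c : I -> R[i]) (M : R[i]) :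
    (forall t : R, 0 < t -> `|\sum_i c i * circ (lam i * t)| <= M) ->
  `|\sum_(i | lam i == mu) c i| <= M.
Proof.
(* The induction is on a list of the frequencies still to be killed. *)
have [S csupp] : exists S : seq R,
    forall i, lam i != mu -> lam i \notin S -> c i = 0.
  by exists [seq lam i | i : I] => i _; rewrite map_f ?mem_enum.
elim: S c csupp => [|nu S IH] c csupp cM.
  have := cM 1 ltr01; rewrite (bigID (fun i => lam i == mu)) /=.
  rewrite [X in _ + X]big1 ?addr0; last first.
    by move=> i nmu; rewrite csupp ?mul0r.
  under eq_bigr => i /eqP -> do rewrite mulr1.
  by rewrite -mulr_suml normrM norm_circ mulr1.
have [numu|numu] := eqVneq nu mu.
  apply: IH cM => i nmu niS; apply: csupp => //.
  by rewrite inE numu negb_or nmu.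
have d0 : `|nu - mu| != 0 by rewrite normr_eq0 subr_eq0.
pose h := (2 * `|nu - mu|)^-1.
have h0 : 0 < h by rewrite invr_gt0 mulr_gt0 // lt_neqAle eq_sym d0 /=.
have kill : circ ((nu - mu) * h) = -1.
  have [x0|x0] := lerP 0 (nu - mu).
    have nz : nu - mu != 0 by rewrite subr_eq0.
    rewrite /h ger0_norm // (_ : _ * _ = 2^-1) ?circ_half //.
    by field.
  have nz : nu - mu != 0 by rewrite subr_eq0.
  rewrite /h ltr0_norm // (_ : _ * _ = - 2^-1) ?circN ?circ_half ?invrN1 //.
  by field.
pose c' i := c i * ((1 + circ ((lam i - mu) * h)) / 2).
suff : `|\sum_(i | lam i == mu) c' i| <= M.
  rewrite (eq_bigr c) // => i /eqP imu.
  by rewrite /c' imu subrr mul0r circ0 -[1 + 1]/2%:R divff ?mulr1 ?pnatr_eq0.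
apply: IH => [i imu iS|t t0].
  have [inu|inu] := eqVneq (lam i) nu.
    by rewrite /c' inu kill subrr mul0r mulr0.
  by rewrite /c' csupp ?mul0r // inE negb_or inu.
have -> : \sum_i c' i * circ (lam i * t) = ((\sum_i c i * circ (lam i * t))
    + circ (- (mu * h)) * \sum_i c i * circ (lam i * (t + h))) / 2.
  rewrite mulr_sumr -big_split /= mulr_suml; apply: eq_bigr => i _.
  rewrite /c' mulrBl mulrDr !circD; ring.
have n2 : `|2^-1 : R[i]| = 2^-1 by rewrite ger0_norm // invr_ge0 ler0n.
rewrite normrM n2 ler_pdivrMr ?ltr0n // (le_trans (ler_normD _ _)) //.
rewrite normrM norm_circ mul1r (_ : M * 2 = M + M); last by ring.
by rewrite lerD // cM // addr_gt0.
Qed.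

(** Exponential growth beats polynomial growth.  With [K = q (1 + d)] and
[p = n (m + 1)], Bernoulli gives [(1 + d)^p >= (1 + n d)^(m + 1)], whereas [p + 1]
is at most a constant [B] times [1 + n d]; so [n d > B^m] is enough. *)
Lemma poly_lt_exp (R : realType) (m : nat) (q K : R) : 0 < q -> q < K ->
  exists p : nat, p.+1%:R ^+ m * q ^+ p < K ^+ p.
Proof.
move=> q0 qK; pose d := K / q - 1.
have d0 : 0 < d by rewrite subr_gt0 ltr_pdivlMr ?mul1r.
have -> : K = q * (1 + d) by rewrite /d; field; rewrite gt_eqF.
pose B := m.+1%:R * (1 + d^-1).
have B0 : 0 < B by rewrite mulr_gt0 // addr_gt0 // invr_gt0.
have [n nB] : exists n : nat, B ^+ m < n%:R * d.
  exists (Num.truncn (B ^+ m / d)).+1; rewrite -ltr_pdivrMr //.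
  exact: truncnS_gt.
have nd0 : 0 < 1 + n%:R * d by rewrite ltr_pwDl // mulr_ge0 // ltW.
exists (n * m.+1)%N; rewrite exprMn mulrC ltr_pM2l ?exprn_gt0 // exprM.
have bern : 1 + n%:R * d <= (1 + d) ^+ n.
  elim: n {nB nd0} => [|n IH]; first by rewrite mul0r addr0.
  rewrite exprS -natr1.
  have : (1 + d) * (1 + n%:R * d) <= (1 + d) * (1 + d) ^+ n.
    by rewrite ler_pM2l // addr_gt0.
  by apply: le_trans; have := ler0n R n; nra.
apply: lt_le_trans (_ : (1 + n%:R * d) ^+ m.+1 <= _); last first.
  by rewrite ler_pXn2r // nnegrE ?exprn_ge0 ?ltW // addr_gt0.
apply: le_lt_trans (_ : (B * (1 + n%:R * d)) ^+ m < _); last first.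
  rewrite exprMn exprSr mulrC ltr_pM2l ?exprn_gt0 //.
  by rewrite (lt_trans nB) // ltrDr.
suff le : (n * m.+1).+1%:R <= B * (1 + n%:R * d).
  by apply: lerXn2r le; rewrite nnegrE; [exact: ler0n|rewrite mulr_ge0 ?ltW].
rewrite /B -mulrA -natr1 natrM (_ : (1 + d^-1) * _ = 1 + d^-1 + n%:R * d + n%:R).
  have : 0 < d^-1 by rewrite invr_gt0.
  have : 0 <= n%:R * d by rewrite mulr_ge0 // ltW.
  have : 1 <= m.+1%:R :> R by rewrite ler1n.
  by have := ler0n R n; nra.
by field; rewrite gt_eqF.
Qed.

(** * Kronecker's theorem *)

(** Bohr's argument: a compatible trigonometric sum of unimodular terms comes
arbitrarily close to its trivial bound. *)
Lemma kronecker_sup (R : realType) (T : finType) (theta alpha : T -> R) (q : R) :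
    (forall l : T -> int, \sum_i (l i)%:~R * theta i = 0 ->
       exists n : int, \sum_i (l i)%:~R * alpha i = n%:~R) ->
    0 < q ->
    (forall t : R, 0 < t -> `|\sum_i circ (t * theta i - alpha i)| <= q%:C) ->
  #|T|%:R <= q.
Proof.
move=> compat q0 supF; rewrite leNgt; apply/negP => qT.
have [p] := poly_lt_exp #|T| q0 qT; apply/negP; rewrite -leNgt.
pose word := {ffun 'I_p -> T}.
pose lam (w : word) := \sum_a theta (w a).
pose phase (w : word) := \sum_a alpha (w a).
pose occ (w : word) i := #|[pred a | w a == i]|.
(* Only the letter counts of a word enter its frequency and phase. *)
have occE (f : T -> R) (w : word) : \sum_a f (w a) = \sum_i (occ w i)%:R * f i.
  rewrite (partition_big w xpredT) //=; apply: eq_bigr => i _.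
  rewrite (eq_bigr (fun=> f i)) => [|a /eqP -> //].
  by rewrite sumr_const mulr_natl.
have phase_lam (w w' : word) : lam w = lam w' -> circ (phase w) = circ (phase w').
  rewrite /lam /phase !occE => eqw.
  have subE (f : T -> R) : \sum_i ((occ w i : int) - (occ w' i : int))%:~R * f i =
      \sum_i (occ w i)%:R * f i - \sum_i (occ w' i)%:R * f i.
    by rewrite -sumrB; apply: eq_bigr => i _; rewrite intrB mulrBl.
  have [|n] := compat (fun i => (occ w i : int) - (occ w' i : int)).
    by rewrite subE eqw subrr.
  by rewrite subE => /eqP; rewrite subr_eq => /eqP ->; rewrite circD circ_int mul1r.
have powF t : (\sum_i circ (t * theta i - alpha i)) ^+ p =
    \sum_(w : word) circ (- phase w) * circ (lam w * t).
  rewrite -[p in LHS]card_ord -prodr_const bigA_distr_bigA /=.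
  apply: eq_bigr => w _; rewrite -circ_sum -circD; congr circ.
  by rewrite sumrB -mulr_sumr addrC mulrC.
(* All terms of a given frequency in F^p carry the same phase, so the modulus of
   their sum is their number. *)
have few (mu : R) : #|[pred w : word | lam w == mu]|%:R <= q ^+ p.
  have [w0 /eqP lw0|none] := pickP (fun w : word => lam w == mu); last first.
    by rewrite eq_card0 ?exprn_ge0 // ltW.
  have /(coef_le_sup mu) : forall t : R, 0 < t ->
      `|\sum_(w : word) circ (- phase w) * circ (lam w * t)| <= (q ^+ p)%:C.
    move=> t t0; rewrite -powF normrX rmorphXn; apply: lerXn2r (supF t t0).
      by rewrite nnegrE normr_ge0.
    by rewrite nnegrE ler0c ltW.
  rewrite (eq_bigr (fun=> circ (- phase w0))) => [|w /eqP lw]; last first.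
    by rewrite !circN (phase_lam w w0) // lw lw0.
  rewrite sumr_const normrMn norm_circ -(rmorph_nat (real_complex R)) lecR.
  by [].
pose cnt (w : word) : {ffun T -> 'I_p.+1} := [ffun i => inord (occ w i)].
have cnt_lam w w' : cnt w = cnt w' -> lam w = lam w'.
  move=> /ffunP eqc; rewrite /lam !occE; apply: eq_bigr => i _; congr (_%:R * _).
  have occp (v : word) : (occ v i < p.+1)%N by rewrite ltnS -[p in (_ <= p)%N]card_ord max_card.
  by have := congr1 val (eqc i); rewrite !ffunE /= !inordK.
have -> : #|T|%:R ^+ p = \sum_(w : word) 1 :> R.
  by rewrite sumr_const -natrX card_ffun card_ord.
(* Count all words by their letter counts, at most [p.+1 ^ #|T|] possibilities. *)
rewrite (partition_big cnt xpredT) //=.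
apply: le_trans (_ : \sum_(v : {ffun T -> 'I_p.+1}) q ^+ p <= _); last first.
  by rewrite sumr_const card_ffun card_ord -natrX mulr_natl.
apply: ler_sum => v _.
have [w0 /eqP cw0|none] := pickP (fun w => cnt w == v); last first.
  by rewrite big_pred0 // exprn_ge0 // ltW.
apply: le_trans (few (lam w0)); rewrite sumr_const ler_nat subset_leq_card //.
apply/fintype.subsetP => w cw; have {}cw : cnt w = v by apply/eqP.
by rewrite inE; apply/eqP/cnt_lam; rewrite cw cw0.
Qed.

Lemma cos_dist_int (R : realType) (x : R) :
  cos (2 * pi * x) = cos (2 * pi * dist_int x).
Proof.
have [[n ->] _] := dist_int_min x.
have -> : cos (2 * pi * x) = cos (2 * pi * (x - n%:~R)).
  have /(congr1 (@complex.Re R)) := circD (x - n%:~R) n%:~R.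
  by rewrite circ_int mulr1 subrK.
have [x0|x0] := lerP 0 (x - n%:~R); first by rewrite ger0_norm.
by rewrite ltr0_norm // mulrN cosN.
Qed.

Lemma dist_int_ge0 (R : realType) (x : R) : 0 <= dist_int x.
Proof. by have [[n ->] _] := dist_int_min x. Qed.

Lemma dist_int_le_half (R : realType) (x : R) : dist_int x <= 2^-1.
Proof.
have [[n dn] min] := dist_int_min x.
set y := x - n%:~R in dn *.
have y_le1 : `|y| <= `|y - 1|.
  by rewrite -dn (_ : y - 1 = x - (n + 1)%:~R) ?min // intrD /y opprD addrA.
have y_leN1 : `|y| <= `|y + 1|.
  by rewrite -dn (_ : y + 1 = x - (n - 1)%:~R) ?min // intrB /y opprB addrA addrAC.
rewrite dn; clearbody y; move: y_le1 y_leN1 {min dn}.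
have [y0|y0] := ger0P y.
  by have [y1|y1] := ger0P (y - 1); lra.
by have [y1|y1] := ger0P (y + 1); lra.
Qed.

(** The sum of [kronecker_sup] is applied to the [theta j] together with one term
of frequency and phase 0, which pins the common direction of the terms to 1: if
[x] is at distance at least [eps] from the integers then [|1 + e(x)| <= d < 2],
which would keep the whole sum away from its trivial bound. *)
Lemma kronecker (R : realType) (k : nat) (theta alpha : 'I_k -> R) :
    (forall l : 'I_k -> int, \sum_j (l j)%:~R * theta j = 0 ->
       exists n : int, \sum_j (l j)%:~R * alpha j = n%:~R) ->
  forall eps : R, 0 < eps ->
    exists2 t : R, 0 < t & forall j, dist_int (t * theta j - alpha j) < eps.
Proof.
move=> compat eps0 eps0_gt0.
apply: contrapT => no_t.
(* [eps <= 1/4] keeps [2 pi eps] in the range where [cos] decreases and makes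
   [d > 0]. *)
pose eps := Num.min eps0 4^-1.
have eps_gt0 : 0 < eps by rewrite lt_min eps0_gt0 invr_gt0 ltr0n.
have eps_quarter : eps <= 4^-1 by rewrite ge_min lexx orbT.
have far t : 0 < t -> exists j, eps <= dist_int (t * theta j - alpha j).
  move=> t0; apply: contrapT => near; apply: no_t; exists t => // j.
  rewrite ltNge; apply/negP => far; apply: near; exists j.
  by rewrite ge_min far.
have pi0 := pi_gt0 R.
pose d := Num.sqrt (2 + 2 * cos (2 * pi * eps)).
have d2 : d < 2.
  have -> : 2 = Num.sqrt (2 ^+ 2) :> R by rewrite sqrtr_sqr ger0_norm.
  rewrite ltr_sqrt ?exprn_gt0 // expr2.
  have : cos (2 * pi * eps) < cos 0; last by rewrite cos0; lra.
  by rewrite ltr_cos ?in_itv /=; nra.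
have d_far x : eps <= dist_int x -> `|1 + circ x| <= d%:C.
  move=> ex; rewrite norm_circD1 lecR ler_wsqrtr // lerD2l ler_pM2l //.
  have xh := dist_int_le_half x.
  by rewrite cos_dist_int leNgt ltr_cos -?leNgt ?in_itv /=; nra.
case: k => [|k] in theta alpha compat no_t far *.
  by have [[]] := far 1 ltr01.
pose th (i : 'I_k.+2) := oapp theta 0 (unlift ord0 i).
pose al (i : 'I_k.+2) := oapp alpha 0 (unlift ord0 i).
have lift_sum (V : zmodType) (f : R -> R -> 'I_k.+2 -> V) :
    \sum_i f (th i) (al i) i =
    f 0 0 ord0 + \sum_j f (theta j) (alpha j) (lift ord0 j).
  rewrite big_ord_recl /th /al unlift_none /=; congr (_ + _).
  by apply: eq_bigr => j _; rewrite liftK.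
have : #|'I_k.+2|%:R <= d + k%:R; last first.
  by rewrite card_ord -!natr1; lra.
apply: (@kronecker_sup _ _ th al) => [l||t t0].
- rewrite (lift_sum _ (fun x _ i => (l i)%:~R * x)) mulr0 add0r => /compat [n ln].
  by exists n; rewrite (lift_sum _ (fun _ x i => (l i)%:~R * x)) mulr0 add0r.
- rewrite ltr_wpDr // sqrtr_gt0.
  suff : 0 <= cos (2 * pi * eps) by lra.
  by rewrite cos_ge0_pihalf //; nra.
have [j jfar] := far t t0.
rewrite (lift_sum _ (fun x y _ => circ (t * x - y))) (bigD1 j) //=.
rewrite addrA mulr0 subr0 circ0.
rewrite (le_trans (ler_normD _ _)) // rmorphD lerD ?d_far //.
rewrite (le_trans (ler_norm_sum _ _ _)) //.
under eq_bigr do rewrite norm_circ.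
by rewrite sumr_const cardC1 card_ord rmorph_nat.
Qed.

(** * Extending characters with values in R/Z *)

(** A homomorphism from a subgroup of [V] to R/Z, encoded by its graph: [H v x]
says that [v] is in the subgroup and that [x] is one of the real numbers allowed
as its value, any two of which differ by an integer. *)
Definition character_mod1 (R : realType) (V : zmodType) (H : V -> R -> Prop) :=
  [/\ H 0 0,
      forall v w x y, H v x -> H w y -> H (v - w) (x - y) &
      forall x, H 0 x -> exists n : int, x = n%:~R].

(** The subgroup of [V * R] generated by [H] and [(w, a)]. *)
Definition adjoin (R : realType) (V : zmodType) (H : V -> R -> Prop) (w : V)
    (a : R) (v : V) (x : R) :=
  exists n : int, H (v - w *~ n) (x - a *~ n).

Lemma character_mulz (R : realType) (V : zmodType) (H : V -> R -> Prop) v x n :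
  character_mod1 H -> H v x -> H (v *~ n) (x *~ n).
Proof.
move=> [H0 HB _] vx.
have HN u y : H u y -> H (- u) (- y) by move=> /(HB _ _ _ _ H0); rewrite !sub0r.
have HD u y u' y' : H u y -> H u' y' -> H (u + u') (y + y').
  by move=> uy /HN u'y'; have := HB _ _ _ _ uy u'y'; rewrite !opprK.
have Hnat (m : nat) : H (v *~ m) (x *~ m).
  by elim: m => [|m IH]; [rewrite !mulr0z|rewrite -addn1 PoszD !mulrzDr !mulr1z; apply: HD].
by case: n => m //; rewrite NegzE !mulrNz; apply: HN.
Qed.

(** If no positive multiple of [w] lies in the domain, any value [a] is consistent.
Otherwise let [n] be the least positive integer with [w *~ n] in the domain, of
value [x0]; then [a] is consistent exactly when [a n = x0] mod 1.  For [n > 1] the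
choices [x0 / n] and [(x0 + 1) / n] are not both integers, so a vector outside the
domain can be given a nontrivial value. *)
Lemma extend_character (R : realType) (V : zmodType) (H : V -> R -> Prop) (w : V) :
  character_mod1 H ->
  exists a : R, character_mod1 (adjoin H w a) /\
    ((exists n : int, a = n%:~R) -> exists x, H w x).
Proof.
move=> charH; have [H0 HB Hint] := charH.
suff [a aP aw] : exists2 a : R,
    (forall n x, H (w *~ n) x -> exists m : int, x - a *~ n = m%:~R) &
    ((exists n : int, a = n%:~R) -> exists x, H w x).
  exists a; split => //; split.
  - by exists 0; rewrite !mulr0z !subrr.
  - move=> v v' x y [n vx] [m vy]; exists (n - m).
    have subACA (W : zmodType) (b c d e : W) : b - c - (d - e) = b - d - (c - e).
      by rewrite !opprD !opprK addrACA.
    by have := HB _ _ _ _ vx vy; rewrite !mulrzBr subACA (subACA _ x).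
  - move=> x [n]; rewrite sub0r => /(character_mulz (-1) charH).
    rewrite !mulrN1z opprK opprB => /aP[m xm].
    by exists (- m); rewrite mulrNz -xm addrAC subrr add0r opprK.
pose order n := (0 < n)%N && `[< exists x, H (w *~ n%:Z) x >].
have [[n ordn]|no_order] := pselect (exists n, order n); last first.
  exists 2^-1; last first.
    move=> [n /(congr1 (fun x => x * 2))]; rewrite mulVf ?pnatr_eq0 //.
    move=> /eqP; rewrite -[1]/(1%:~R) -[2]/(2%:~R) -intrM eqr_int => /eqP.
    move=> n2; exfalso; suff : (2 %| 1)%Z by [].
    by apply/dvdzP; exists n.
  have order0 n x : H (w *~ n) x -> n = 0.
    case: n => [[|n]|n] // wx; case: no_order; exists n.+1; apply/andP; split=> //;
      apply/asboolP; first by exists x.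
    have := character_mulz (-1) charH wx.
    by rewrite NegzE !mulrN1z mulrNz opprK; exists (- x).
  move=> n x wx; have n0 := order0 _ _ wx; rewrite n0 mulr0z in wx *.
  by have [m ->] := Hint _ wx; exists m; rewrite subr0.
case: (ex_minnP (ex_intro _ n ordn)) => {n ordn} n /andP[n0 /asboolP[x0 wx0]] n_min.
(* By minimality of [n], division with remainder leaves remainder 0. *)
have n_dvd m x : H (w *~ m) x -> exists q : int, m = q * n.
  move=> wx; exists (m %/ n)%Z; rewrite {1}(divz_eq m n).
  have := HB _ _ _ _ wx (character_mulz (m %/ n)%Z charH wx0).
  rewrite -mulrzA -mulrzBr [X in m - X]mulrC {1}(divz_eq m n) addrAC subrr add0r.
  have r0 : (0 <= m %% n)%Z by rewrite modz_ge0 // eqz_nat -lt0n.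
  have rn : (m %% n < n)%Z by rewrite ltz_pmod.
  case: (m %% n)%Z r0 rn => // r _ rn wr.
  case: r => [|r] in rn wr *; first by rewrite addr0.
  have /n_min : order r.+1 by apply/andP; split => //; apply/asboolP; eexists; exact: wr.
  by rewrite leqNgt -ltz_nat rn.
have nR : n%:R != 0 :> R by rewrite pnatr_eq0 -lt0n.
have works (a : R) (z : int) : a *~ n = x0 + z%:~R ->
    forall m x, H (w *~ m) x -> exists m' : int, x - a *~ m = m'%:~R.
  move=> an m x wx; have [q mq] := n_dvd _ _ wx.
  have := HB _ _ _ _ wx (character_mulz q charH wx0).
  rewrite -mulrzA mq [n%:Z * q]mulrC subrr => /Hint[m' xm'].
  exists (m' - z * q); rewrite intrB -xm' [q * n%:Z]mulrC (mulrzA a) an.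
  by rewrite mulrzDl opprD addrA (mulrzA 1).
have [[z0 xz0]|nint] := pselect (exists z : int, x0 / n%:R = z%:~R); last first.
  exists (x0 / n%:R) => //; apply: (@works _ 0).
  by rewrite mulr0z addr0 -mulrzr divfK.
exists ((x0 + 1) / n%:R).
  by apply: (@works _ 1); rewrite -mulrzr divfK.
(* If both candidates are integers then [n] divides 1 and [w] is in the domain. *)
move=> [z1]; rewrite mulrDl xz0 => /(congr1 (fun x => x * n%:R)).
rewrite mulrDl mul1r mulVf // => /eqP.
rewrite -[n%:R]/(n%:Z%:~R) -[1]/(1%:~R) -!intrM -intrD eqr_int => /eqP e1.
have : (n %| 1)%Z.
  by apply/dvdzP; exists (z1 - z0); rewrite mulrBl -e1 addrAC subrr add0r.
rewrite dvdz1 => /eqP /= n1; exists x0.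
by move: wx0; rewrite n1 mulr1z.
Qed.

Lemma extend_character_seq (R : realType) (V : zmodType) (H : V -> R -> Prop)
    (ws : seq V) :
  character_mod1 H ->
  exists H' : V -> R -> Prop,
    [/\ character_mod1 H', forall v x, H v x -> H' v x &
        forall w, w \in ws -> exists a, H' w a].
Proof.
elim: ws => [|w ws IH] charH; first by exists H.
have [H1 [charH1 HH1 dom]] := IH charH.
have [a [charH2 _]] := extend_character w charH1.
have H12 v x : H1 v x -> adjoin H1 w a v x.
  by move=> vx; exists 0; rewrite !mulr0z !subr0.
exists (adjoin H1 w a); split=> [//|v x /HH1/H12 //|v].
rewrite inE => /predU1P[->|/dom[b /H12]]; last by exists b.
by exists a, 1; rewrite !mulr1z !subrr; case: charH1.
Qed.

(** The zero character of [M] is extended first to [w], with a nonzero value mod 1,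
and then to the basis vectors; their values are [rho]. *)
Lemma separating_character (R : realType) (s : nat) (M : {ffun 'I_s -> int} -> Prop)
    (w : {ffun 'I_s -> int}) :
  M 0 -> (forall u v, M u -> M v -> M (u - v)) -> ~ M w ->
  exists rho : 'I_s -> R,
    (forall m, M m -> exists n : int, \sum_r rho r *~ m r = n%:~R) /\
    ~ exists n : int, \sum_r rho r *~ w r = n%:~R.
Proof.
move=> M0 MB Mw.
pose H v (x : R) := M v /\ exists n : int, x = n%:~R.
have charH : character_mod1 H.
  split=> [|u v x y [Mu [n ->]] [Mv [m ->]]|x []//].
    by split=> //; exists 0.
  by split; [exact: MB|exists (n - m); rewrite intrB].
have [a [charHa a_nint]] := extend_character w charH.
pose unit_ (r : 'I_s) : {ffun 'I_s -> int} := [ffun i => (i == r)%:Z].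
have [H' [charH' HaH' dom]] := extend_character_seq [seq unit_ r | r : 'I_s] charHa.
have /choice[rho rhoP] : forall r, exists x, H' (unit_ r) x.
  by move=> r; apply: dom; rewrite map_f ?mem_enum.
have [H'0 H'B H'int] := charH'.
have H'sum m : H' m (\sum_r rho r *~ m r).
  have {1}-> : m = \sum_r unit_ r *~ m r.
    apply/ffunP => i; rewrite sum_ffunE (bigD1 i) //= big1 => [|r ri].
      by rewrite addr0 ffunMzE ffunE eqxx -mulrzl mulr1 intz.
    by rewrite ffunMzE ffunE eq_sym (negPf ri) mul0rz.
  apply: (big_ind2 H') => // [u x v y ux vy|r _].
    have := H'B _ _ _ _ ux (H'B _ _ _ _ H'0 vy).
    by rewrite !sub0r !opprK.
  exact: character_mulz.
have H'val m x : H' m x -> exists n : int, \sum_r rho r *~ m r - x = n%:~R.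
  by move=> /(H'B _ _ _ _ (H'sum m)); rewrite subrr; apply: H'int.
exists rho; split=> [m Mm|[n wn]].
  have /H'val : H' m 0.
    by apply: HaH'; exists 0; rewrite !mulr0z !subr0; split=> //; exists 0.
  by rewrite subr0.
have /H'val[n'] : H' w a.
  by apply: HaH'; exists 1; rewrite !mulr1z !subrr; case: charH.
rewrite wn => an; have [|x [//]] := a_nint.
by exists (n - n'); rewrite intrB -an; ring.
Qed.

(** * Partitions and limit phases *)

Lemma ordered_partition_index (k s : nat) (Pi : 'I_s -> {set 'I_k}) :
  is_ordered_partition Pi ->
  exists part : 'I_k -> 'I_s, forall r j, (j \in Pi r) = (part j == r).
Proof.
move=> [Pi_inj /and3P[/eqP coverPi trivPi _]].
have /choice[part partP] : forall j, exists r, j \in Pi r.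
  move=> j; have : j \in finset.cover [set Pi r | r : 'I_s]%SET by rewrite coverPi inE.
  by move=> /finset.bigcupP[_ /imsetP[r _ ->] jr]; exists r.
exists part => r j; apply/idP/eqP => [jr|<- //].
apply: Pi_inj; apply: contraTeq jr => part_r.
have inPi i : Pi i \in [set Pi r | r : 'I_s]%SET by exact: imset_f.
have /disjoint_setI0/setP/(_ j) :=
  elimT finset.trivIsetP trivPi _ _ (inPi (part j)) (inPi r) part_r.
by rewrite !inE partP /= => ->.
Qed.

Lemma sum_by_parts (R : realType) (k s : nat) (Pi : 'I_s -> {set 'I_k})
    (part : 'I_k -> 'I_s) (l : 'I_k -> int) (rho : 'I_s -> R) :
  (forall r j, (j \in Pi r) = (part j == r)) ->
  \sum_j (l j)%:~R * rho (part j) = \sum_r rho r *~ \sum_(j in Pi r) l j.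
Proof.
move=> partE; rewrite (partition_big part xpredT) //=; apply: eq_bigr => r _.
rewrite (eq_bigl _ _ (partE r)).
by rewrite mulrz_sumr; apply: eq_bigr => j /eqP ->; rewrite mulrzl.
Qed.

Lemma dist_int0 (R : realType) (x : R) : dist_int x = 0 -> exists n : int, x = n%:~R.
Proof.
have [[n ->] _] := dist_int_min x.
by move=> /normr0_eq0/subr0_eq ->; exists n.
Qed.

(** The combination [\sum_j l j * (t theta j - alpha j)] equals
[- \sum_j l j * alpha j] exactly and is within [eps] of an integer when every term
[t theta j - alpha j] is close enough to one. *)
Lemma limit_phase_int (R : realType) (k : nat) (theta alpha : 'I_k -> R)
    (l : 'I_k -> int) :
    (forall eps : R, 0 < eps ->
       exists t : R, forall j, dist_int (t * theta j - alpha j) < eps) ->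
    \sum_j (l j)%:~R * theta j = 0 ->
  exists n : int, \sum_j (l j)%:~R * alpha j = n%:~R.
Proof.
move=> near rel; apply: dist_int0; apply/eqP.
rewrite eq_le dist_int_ge0 andbT; apply/ler_addgt0Pl => eps eps0; rewrite addr0.
(* The summand 1 only makes [L] positive. *)
pose L : R := 1 + \sum_j `|(l j)%:~R|.
have L0 : 0 < L by rewrite ltr_pwDl // sumr_ge0.
have [t near_t] := near _ (divr_gt0 eps0 L0).
have /choice[n nP] : forall j, exists n : int,
    `|t * theta j - alpha j - n%:~R| < eps / L.
  move=> j; have := near_t j.
  by have [[n ->] _] := dist_int_min (t * theta j - alpha j); exists n.
have [_ /(_ (- \sum_j l j * n j)) /le_trans] := dist_int_min (\sum_j (l j)%:~R * alpha j).
apply.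
have -> : \sum_j (l j)%:~R * alpha j - (- \sum_j l j * n j)%:~R
    = - \sum_j (l j)%:~R * (t * theta j - alpha j - (n j)%:~R).
  have -> : \sum_j (l j)%:~R * (t * theta j - alpha j - (n j)%:~R) =
      t * (\sum_j (l j)%:~R * theta j) - \sum_j (l j)%:~R * alpha j
      - \sum_j (l j * n j)%:~R.
    rewrite mulr_sumr -!sumrB; apply: eq_bigr => j _; rewrite intrM; ring.
  by rewrite rel mulrNz opprK rmorph_sum /=; ring.
rewrite normrN (le_trans (ler_norm_sum _ _ _)) //.
apply: le_trans (_ : \sum_j `|(l j)%:~R| * (eps / L) <= _).
  by apply: ler_sum => j _; rewrite normrM ler_wpM2l // ltW.
rewrite -mulr_suml mulrCA ger_pMr // ler_pdivrMr // mul1r /L lerDr //.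
Qed.

Theorem lemma2p9 (R : realType) (k s : nat) (theta : 'I_k -> R)
    (Pi : 'I_s -> {set 'I_k}) (Pi_partition : is_ordered_partition Pi) :
  non_degenerate theta Pi <->
  exists r1 r2 : 'I_s, r1 <> r2 /\
    ~ exists l : 'I_k -> int,
        [/\ \sum_(j < k) (l j)%:~R * theta j = 0,
            forall r : 'I_s, r <> r1 -> r <> r2 -> \sum_(j in Pi r) l j = 0,
            \sum_(j in Pi r1) l j = -1 &
            \sum_(j in Pi r2) l j = 1].
Proof.
have [part partE] := ordered_partition_index Pi_partition.
have diff_sum (rho : 'I_s -> R) (m : 'I_s -> int) (r1 r2 : 'I_s) : r1 <> r2 ->
    (forall r, r <> r1 -> r <> r2 -> m r = 0) -> m r1 = -1 -> m r2 = 1 ->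
    \sum_r rho r *~ m r = rho r2 - rho r1.
  move=> /eqP r12 m0 m1 m2; rewrite (bigD1 r2) // (bigD1 r1) //= big1.
    by rewrite m1 m2 mulr1z mulrN1z addr0.
  by move=> r /andP[/eqP rr2 /eqP rr1]; rewrite m0.
split=> [[rho [rho_var near]]|[r1 [r2 [r12 no_l]]]].
- apply: contrapT => all_l; apply: rho_var => r2 r1.
  have [<-|/eqP r12] := eqVneq r1 r2; first by exists 0; rewrite subrr.
  have [l [rel m0 m1 m2]] : exists l : 'I_k -> int,
      [/\ \sum_(j < k) (l j)%:~R * theta j = 0,
          forall r : 'I_s, r <> r1 -> r <> r2 -> \sum_(j in Pi r) l j = 0,
          \sum_(j in Pi r1) l j = -1 & \sum_(j in Pi r2) l j = 1].
    by apply: contrapT => no_l; apply: all_l; exists r1, r2.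
  have [|n] := @limit_phase_int _ _ theta (rho \o part) l _ rel.
    move=> eps /near[t _ tP]; exists t => j /=.
    by apply: tP; rewrite partE.
  rewrite (sum_by_parts _ _ partE) (diff_sum _ _ _ _ r12 m0 m1 m2).
  by exists n.
pose M (m : {ffun 'I_s -> int}) := exists l : 'I_k -> int,
  \sum_j (l j)%:~R * theta j = 0 /\ forall r, m r = \sum_(j in Pi r) l j.
pose w : {ffun 'I_s -> int} := [ffun r => (r == r2)%:Z - (r == r1)%:Z].
have w1 : w r1 = -1 by rewrite ffunE eqxx (negPf (introN eqP r12)).
have w2 : w r2 = 1 by rewrite ffunE eqxx eq_sym (negPf (introN eqP r12)).
have w0 r : r <> r1 -> r <> r2 -> w r = 0.
  by move=> /eqP/negPf rr1 /eqP/negPf rr2; rewrite ffunE rr1 rr2.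
have [||[l [rel lw]]|rho [rhoM rhow]] := @separating_character R s M w.
- exists (fun=> 0); split=> [|r]; first by rewrite big1 // => j _; rewrite mul0r.
  by rewrite big1 ?ffunE.
- move=> u v [lu [relu mu]] [lv [relv mv]]; exists (fun j => lu j - lv j).
  split=> [|r]; last by rewrite !ffunE mu mv sumrB.
  under eq_bigr => j _ do rewrite intrB mulrBl.
  by rewrite sumrB relu relv subrr.
- apply: no_l; exists l; split=> [//|r rr1 rr2||]; rewrite -lw //.
  exact: w0.
exists rho; split=> [rho_const|eps eps0].
  by apply: rhow; rewrite (diff_sum _ _ _ _ r12 w0 w1 w2); apply: rho_const.
have [|t t0 tP] := @kronecker _ _ theta (rho \o part) _ eps eps0.
  move=> l rel; rewrite (sum_by_parts _ _ partE).
  have [|n mn] := rhoM [ffun r => \sum_(j in Pi r) l j].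
    by exists l; split=> // r; rewrite ffunE.
  by exists n; rewrite -mn; apply: eq_bigr => r _; rewrite ffunE.
by exists t => // r j; rewrite partE => /eqP <-; apply: tP.
Qed.
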